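(* Let $\mathbf{A}\in\mathbb{C}^{m\times n}$ have rank $r\ge 1$. Then the Moore–Penrose inverse $\mathbf{A}^{+}\in\mathbb{C}^{n\times m}$ of $\mathbf{A}$ can be represented as $$\mathbf{A}^{+}=\left(\frac{l_{ij}}{d_{r}(\mathbf{A}^{*}\mathbf{A})}\right)_{n\times m},\qquad l_{ij}=\sum_{\beta\in J_{r,n}\{i\}}\left|\left((\mathbf{A}^{*}\mathbf{A})_{.\,i}(\mathbf{a}^{*}_{.j})\right)^{\beta}_{\beta}\right|,\qquad d_{r}(\mathbf{A}^{*}\mathbf{A})=\sum_{\beta\in J_{r,n}}\left|(\mathbf{A}^{*}\mathbf{A})^{\beta}_{\beta}\right|,$$ and it can also be represented as $$\mathbf{A}^{+}=\left(\frac{r_{ij}}{d_{r}(\mathbf{A}\mathbf{A}^{*})}\right)_{n\times m},\qquad r_{ij}=\sum_{\alpha\in I_{r,m}\{j\}}\left|\left((\mathbf{A}\mathbf{A}^{*})_{j\,.}(\mathbf{a}^{*}_{i\,.})\right)^{\alpha}_{\alpha}\right|,\qquad d_{r}(\mathbf{A}\mathbf{A}^{*})=\sum_{\alpha\in I_{r,m}}\left|(\mathbf{A}\mathbf{A}^{*})^{\alpha}_{\alpha}\right|,$$ where $1\le i\le n$ and $1\le j\le m$.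
   Context: $\mathbf{A}^{*}$ is the conjugate transpose of $\mathbf{A}$; $\mathbf{a}^{*}_{.j}$ and $\mathbf{a}^{*}_{i.}$ denote the $j$th column and the $i$th row of $\mathbf{A}^{*}$. The Moore–Penrose inverse of $\mathbf{A}\in\mathbb{C}^{m\times n}$ is the unique $\mathbf{A}^{+}\in\mathbb{C}^{n\times m}$ with $\mathbf{A}\mathbf{A}^{+}\mathbf{A}=\mathbf{A}$, $\mathbf{A}^{+}\mathbf{A}\mathbf{A}^{+}=\mathbf{A}^{+}$, $(\mathbf{A}\mathbf{A}^{+})^{*}=\mathbf{A}\mathbf{A}^{+}$, $(\mathbf{A}^{+}\mathbf{A})^{*}=\mathbf{A}^{+}\mathbf{A}$. For a matrix $\mathbf{B}$, $\mathbf{B}_{.\,i}(\mathbf{b})$ is the matrix obtained from $\mathbf{B}$ by replacing its $i$th column by the column vector $\mathbf{b}$, and $\mathbf{B}_{j\,.}(\mathbf{b})$ is the matrix obtained by replacing its $j$th row by the row vector $\mathbf{b}$. For $1\le k\le n$, $J_{k,n}$ is the set of all strictly increasing sequences of $k$ integers chosen from $\{1,\dots,n\}$ (equivalently, $k$-element subsets), and $J_{k,n}\{i\}$ is the set of those $\beta\in J_{k,n}$ containing $i$; similarly $I_{k,m}$ is the set of strictly increasing sequences of $k$ integers from $\{1,\dots,m\}$ and $I_{k,m}\{j\}$ the set of those containing $j$. $|\mathbf{B}^{\alpha}_{\alpha}|$ denotes the principal minor of the square matrix $\mathbf{B}$ with rows and columns indexed by $\alpha$. *)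

(* Defs.v *)
From HB Require Import structures.
From mathcomp Require Import all_boot all_order all_algebra.
From mathcomp Require Import sesquilinear spectral.
From mathcomp Require Import reals complex.

Set Implicit Arguments.
Unset Strict Implicit.
Unset Printing Implicit Defensive.

Import Order.TTheory GRing.Theory Num.Theory.
Local Open Scope ring_scope.
Local Open Scope sesquilinear_scope.

Section PrincipalMinors.
Variable C : comNzRingType.

Definition subst_col m n (B : 'M[C]_(m, n)) (i : 'I_n) (b : 'cV[C]_m) :=
  \matrix_(k, l) (if l == i then b k 0 else B k l).

Definition subst_row m n (B : 'M[C]_(m, n)) (j : 'I_m) (b : 'rV[C]_n) :=
  \matrix_(k, l) (if k == j then b 0 l else B k l).

(* [enum_val : 'I_#|b| -> 'I_n] lists the elements of [b] in increasing order. *)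
Definition principal_minor n (B : 'M[C]_n) (b : {set 'I_n}) : C :=
  \det (mxsub (@enum_val _ (mem b)) (@enum_val _ (mem b)) B).

End PrincipalMinors.

(* Strictly increasing sequences of length k are encoded by their underlying
   sets.  [idx_sets k n] is both J_{k,n} and I_{k,n}; [idx_sets_at k i] is both
   J_{k,n}{i} and I_{k,n}{i}. *)
Definition idx_sets (k n : nat) : {set {set 'I_n}} :=
  [set b : {set 'I_n} | #|b| == k].

Definition idx_sets_at (k n : nat) (i : 'I_n) : {set {set 'I_n}} :=
  [set b in idx_sets k n | i \in b].

(* d_k(B). *)
Definition sum_principal_minors (C : comNzRingType) k n (B : 'M[C]_n) : C :=
  \sum_(b in idx_sets k n) principal_minor B b.

Section MoorePenrose.
Variable C : numClosedFieldType.

Definition is_mpinv m n (A : 'M[C]_(m, n)) (X : 'M[C]_(n, m)) : bool :=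
  [&& A *m X *m A == A, X *m A *m X == X,
      (A *m X) ^t* == A *m X & (X *m A) ^t* == X *m A].

Lemma trmxC_mul m n p (A : 'M[C]_(m, n)) (B : 'M[C]_(n, p)) :
  (A *m B) ^t* = B ^t* *m A ^t*.
Proof. by rewrite trmx_mul map_mxM. Qed.

Lemma mulmx_trmxC_eq0 m n (A : 'M[C]_(m, n)) : A *m A ^t* = 0 -> A = 0.
Proof.
move=> A0; apply/matrixP=> i j; rewrite !mxE.
have /eqP : (A *m A ^t*) i i = 0 by rewrite A0 mxE.
rewrite !mxE psumr_eq0 => [/allP/(_ j)|k _]; last by rewrite !mxE mul_conjC_ge0.
by rewrite mem_index_enum !mxE mul_conjC_eq0 => /(_ isT)/eqP.
Qed.

Lemma row_free_gram_unit r n (B : 'M[C]_(r, n)) :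
  row_free B -> B *m B ^t* \in unitmx.
Proof.
move=> fB; rewrite -row_free_unit; apply/inj_row_free => v vB0.
apply/(row_free_inj fB)/eqP; rewrite mul0mx; apply/eqP/mulmx_trmxC_eq0.
by rewrite trmxC_mul mulmxA -(mulmxA v) vB0 mul0mx.
Qed.

Lemma row_full_gram_unit m r (F : 'M[C]_(m, r)) :
  row_full F -> F ^t* *m F \in unitmx.
Proof.
move=> fF; have := @row_free_gram_unit _ _ (F ^t*).
by rewrite trmxCK; apply; rewrite /row_free mxrank_map mxrank_tr.
Qed.

Lemma trmxC_inv n (M : 'M[C]_n) : (invmx M) ^t* = invmx (M ^t*).
Proof. by rewrite trmx_inv map_invmx. Qed.

Lemma is_mpinv_full_rank m n r (F : 'M[C]_(m, r)) (B : 'M[C]_(r, n)) :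
    row_full F -> row_free B ->
  is_mpinv (F *m B)
    (B ^t* *m invmx (B *m B ^t*) *m invmx (F ^t* *m F) *m F ^t*).
Proof.
move=> /row_full_gram_unit uF /row_free_gram_unit uB.
set GB := invmx (B *m B ^t*); set GF := invmx (F ^t* *m F).
have GBt : GB ^t* = GB by rewrite trmxC_inv trmxC_mul trmxCK.
have GFt : GF ^t* = GF by rewrite trmxC_inv trmxC_mul trmxCK.
have BG : B *m B ^t* *m GB = 1%:M by rewrite mulmxV.
have GFF : GF *m (F ^t* *m F) = 1%:M by rewrite mulVmx.
set X := _ *m F ^t*.
have AX : F *m B *m X = F *m GF *m F ^t*.
  by rewrite /X !mulmxA -(mulmxA F B) -(mulmxA F (B *m _)) BG mulmx1.
have XA : X *m (F *m B) = B ^t* *m GB *m B.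
  by rewrite /X !mulmxA -(mulmxA _ (F ^t*) F) -(mulmxA _ GF) GFF mulmx1.
apply/and4P; split; apply/eqP.
- by rewrite AX !mulmxA -(mulmxA _ (F ^t*) F) -(mulmxA _ GF) GFF mulmx1.
- by rewrite XA /X !mulmxA -(mulmxA _ B) -(mulmxA _ (B *m _)) BG mulmx1.
- by rewrite AX !trmxC_mul trmxCK GFt mulmxA.
- by rewrite XA !trmxC_mul trmxCK GBt mulmxA.
Qed.

Lemma mpinv_exists m n (A : 'M[C]_(m, n)) : exists X, is_mpinv A X.
Proof.
have := is_mpinv_full_rank (col_base_full A) (row_base_free A).
by rewrite mulmx_base => ?; eexists; eassumption.
Qed.

Lemma mpinv_unique m n (A : 'M[C]_(m, n)) (X Y : 'M[C]_(n, m)) :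
  is_mpinv A X -> is_mpinv A Y -> X = Y.
Proof.
case/and4P=> /eqP AXA /eqP XAX /eqP AXt /eqP XAt.
case/and4P=> /eqP AYA /eqP YAY /eqP AYt /eqP YAt.
have AXY : A *m X = A *m Y.
  by rewrite -AXt -{1}AYA -(mulmxA (A *m Y)) trmxC_mul AXt AYt mulmxA AXA.
have XYA : X *m A = Y *m A.
  by rewrite -XAt -{1}AYA -(mulmxA A) mulmxA trmxC_mul XAt YAt -mulmxA (mulmxA A) AXA.
by rewrite -XAX XYA -mulmxA AXY mulmxA YAY.
Qed.

Definition mpinv m n (A : 'M[C]_(m, n)) : 'M[C]_(n, m) :=
  xchoose (mpinv_exists A).

Lemma mpinvP m n (A : 'M[C]_(m, n)) : is_mpinv A (mpinv A).
Proof. exact: xchooseP. Qed.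

Lemma mpinv_eq m n (A : 'M[C]_(m, n)) X : is_mpinv A X -> mpinv A = X.
Proof. exact: mpinv_unique (mpinvP A). Qed.

End MoorePenrose.

(* Main.v *)
Require Import Defs.
From mathcomp Require Import all_boot all_order all_algebra perm.
From mathcomp Require Import sesquilinear spectral.
From mathcomp Require Import reals complex.

Set Implicit Arguments.
Unset Strict Implicit.
Unset Printing Implicit Defensive.

Local Open Scope ring_scope.
Local Open Scope sesquilinear_scope.

Import GRing.Theory.

(** Write A = F B with F of full column rank r and B of full row rank r, so
    that A^+ = B^H (B B^H)^-1 (F^H F)^-1 F^H, where ^H is the conjugate
    transpose.  With P = B^H and V = F^H F B one has A^H A = P V, a product
    through dimension r whose reversed product V P = (F^H F) (B B^H) is an
    invertible r x r matrix, and A^+ = P (V P)^-1 F^H.  The formula for A^+ is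
    then Cramer's rule for V P, transported from r x r determinants to
    principal minors of P V.

    The transport is the Cauchy-Binet formula in the form d_r(P V) = det(V P)
    ([sum_principal_minors_mulmx]).  It gives the denominator at once.  For the
    numerator, the j-th column of A^H is P u with u the j-th column of F^H, so
    substituting it for column i of P V amounts to substituting u for column i
    of V ([subst_col_mulmx]).  Minors on index sets avoiding i do not see the
    substituted column, and minors on index sets containing i vanish when that
    column is 0; hence the sum restricted to the sets containing i is a
    difference of two full sums, the ones for u and for 0
    ([sum_principal_minors_at]).  By Cauchy-Binet both are r x r determinants
    of rank-one perturbations of V P, and the matrix determinant lemma
    ([det_add_rank1]) evaluates the difference as
    det(V P) times the i-th entry of P (V P)^-1 u
    ([sum_principal_minors_subst_col]).

    The row formula is the column formula for the transpose of A, since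
    transposition commutes with the Moore-Penrose inverse ([mpinv_tr]) and
    preserves principal minors. *)

Section PrincipalMinorSums.
Variable C : comNzRingType.

(** Each row of [V *m P] is a combination of rows of [P]; this expands the
    determinant multilinearly in all rows.  The choice functions [f] need not
    be injective: those that are not contribute two equal rows. *)
Lemma det_mulmx_ffun r n (V : 'M[C]_(r, n)) (P : 'M[C]_(n, r)) :
  \det (V *m P) =
    \sum_(f : {ffun 'I_r -> 'I_n})
       (\prod_i V i (f i)) * \det (mxsub f id P).
Proof.
under [RHS]eq_bigr do rewrite big_distrr /=.
rewrite exchange_big; apply: eq_bigr => /= s _.
under eq_bigr => i _ do rewrite mxE.
rewrite (bigA_distr_bigA (fun i k => V i k * P k (s i))) big_distrr /=.
apply: eq_bigr => f _; rewrite mulrCA big_split; congr (_ * (_ * _)).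
by apply: eq_bigr => i _; rewrite mxE.
Qed.

Lemma det_rowsub_noninj r n (f : 'I_r -> 'I_n) (P : 'M[C]_(n, r)) :
  ~~ injectiveb f -> \det (mxsub f id P) = 0.
Proof.
case/injectivePn=> i [j ne_ij eq_f].
by apply: (determinant_alternate ne_ij) => k; rewrite !mxE eq_f.
Qed.

(** The minor on [b] is itself the determinant of a square product through the
    index set [b], so the expansion over choice functions applies to it too;
    composing a choice function with the enumeration of [b] identifies the
    injective ones with the injections of image [b].  Expanding both sides in
    the same way avoids any bookkeeping of permutation signs. *)
Lemma principal_minor_mulmx r n (V : 'M[C]_(r, n)) (P : 'M[C]_(n, r))
    (b : {set 'I_n}) :
  #|b| = r ->
  principal_minor (P *m V) b =
    \sum_(f : {ffun 'I_r -> 'I_n} | injectiveb f && (f @: setT == b))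
       (\prod_i V i (f i)) * \det (mxsub f id P).
Proof.
(* Principal minors on [b] have size [#|b|]; taking [r] to be that very number
   spares all casts. *)
move=> cardb; case: r / cardb in V P *.
(* Over the square factors the product may be reversed, which brings it to the
   shape of the expansion. *)
rewrite /principal_minor mxsub_mul det_mulmx mulrC -det_mulmx det_mulmx_ffun.
rewrite (bigID (fun g : {ffun _} => injectiveb g)) /= [X in _ + X]big1.
  pose e (g : {ffun 'I_#|b| -> 'I_#|b|}) :=
    [ffun i => @enum_val _ (mem b) (g i)].
  (* [enum_rank_in] wants an element of [b]; the enumerated one will do. *)
  pose e' (f : {ffun 'I_#|b| -> 'I_n}) :=
    [ffun i => enum_rank_in (enum_valP i) (f i)].
  rewrite addr0 (reindex_onto e e') /=.
    apply: eq_big => [g | g _].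
      rewrite [in RHS]andbC; have -> /= : e' (e g) == g.
        by apply/eqP/ffunP=> i; rewrite !ffunE enum_valK_in.
      have -> : injectiveb (e g) = injectiveb g.
        apply/injectiveP/injectiveP => inj_g i j eq_g; apply: inj_g.
          by rewrite !ffunE eq_g.
        by move: eq_g; rewrite !ffunE; apply: enum_val_inj.
      case: injectiveP => // inj_g.
      rewrite eqEcard card_imset ?cardsT ?card_ord.
        rewrite leqnn andbT; apply/esym/subsetP=> _ /imsetP[i _ ->].
        by rewrite ffunE; apply: enum_valP.
      by move=> i j; rewrite !ffunE => /enum_val_inj/inj_g.
    congr (_ * _); first by apply: eq_bigr => i _; rewrite mxE ffunE.
    by congr (determinant _); apply/matrixP=> i j; rewrite !mxE ffunE.
  move=> f /andP[_ /eqP imf]; apply/ffunP=> i; rewrite !ffunE enum_rankK_in //.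
  have : f i \in f @: setT by rewrite imset_f.
  by rewrite imf.
by move=> g ninj; rewrite (det_rowsub_noninj _ ninj) mulr0.
Qed.

(** The Cauchy-Binet formula: sort the injective choice functions by image. *)
Lemma sum_principal_minors_mulmx r n (V : 'M[C]_(r, n)) (P : 'M[C]_(n, r)) :
  sum_principal_minors r (P *m V) = \det (V *m P).
Proof.
rewrite det_mulmx_ffun (bigID (fun f : {ffun _} => injectiveb f)) /=.
rewrite [X in _ = _ + X]big1 => [|f ninj]; last first.
  by rewrite (det_rowsub_noninj _ ninj) mulr0.
rewrite addr0.
rewrite (partition_big (fun f : {ffun _} => f @: setT) (mem (idx_sets r n))).
  apply: eq_bigr => b; rewrite inE => /eqP cardb.
  exact: principal_minor_mulmx.
by move=> f /injectiveP injf; rewrite /= inE card_imset // cardsT card_ord.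
Qed.

(** Sylvester's identity: both sides are the determinant of the block matrix
    with rows (1, -A) and (B, 1), by block elimination from either side. *)
Lemma det_add1_mulmxC m n (A : 'M[C]_(m, n)) (B : 'M[C]_(n, m)) :
  \det (1%:M + A *m B) = \det (1%:M + B *m A).
Proof.
have : block_mx 1%:M (- A) 0 1%:M *m block_mx (1%:M + A *m B) 0 B 1%:M =
       block_mx 1%:M 0 B 1%:M *m block_mx 1%:M (- A) 0 (1%:M + B *m A).
  rewrite !mulmx_block !(mul1mx, mul0mx, mulmx1, mulmx0) !(addr0, add0r).
  by rewrite mulNmx mulmxN addrK addrCA addNr addr0.
move/(congr1 determinant); rewrite !det_mulmx !(det_ublock, det_lblock) !det1.
by rewrite !mul1r !mulr1.
Qed.

Lemma subst_col_mulmx m n p (P : 'M[C]_(m, n)) (V : 'M[C]_(n, p)) i u :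
  subst_col (P *m V) i (P *m u) = P *m subst_col V i u.
Proof.
apply/matrixP=> k l; rewrite !mxE; case: eqP => [->|/eqP ne].
  by apply: eq_bigr => j _; rewrite mxE eqxx.
by apply: eq_bigr => j _; rewrite mxE (negbTE ne).
Qed.

Lemma subst_colE m n (B : 'M[C]_(m, n)) i u :
  subst_col B i u = B + (u - col i B) *m delta_mx 0 i.
Proof.
apply/matrixP=> k l; rewrite !mxE big_ord1 !mxE eqxx /=.
by case: eqP => [->|_]; rewrite ?mulr1 ?mulr0 ?addr0 // addrC subrK.
Qed.

Lemma principal_minor_subst_col0 n (B : 'M[C]_n) i (b : {set 'I_n}) :
  i \in b -> principal_minor (subst_col B i 0) b = 0.
Proof.
move=> ib; rewrite /principal_minor (expand_det_col _ (enum_rank_in ib i)).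
by apply: big1 => j _; rewrite !mxE enum_rankK_in // eqxx mul0r.
Qed.

Lemma principal_minor_subst_col_notin n (B : 'M[C]_n) i u v (b : {set 'I_n}) :
  i \notin b ->
  principal_minor (subst_col B i u) b = principal_minor (subst_col B i v) b.
Proof.
move=> ib; congr (\det _); apply/matrixP=> k l; rewrite !mxE.
by case: eqP => // il; rewrite -il enum_valP in ib.
Qed.

(** Trades the constraint [i \in b] for a difference of unconstrained sums, to
    which the Cauchy-Binet formula applies. *)
Lemma sum_principal_minors_at r n (B : 'M[C]_n) i u :
  \sum_(b in idx_sets_at r i) principal_minor (subst_col B i u) b =
  sum_principal_minors r (subst_col B i u)
    - sum_principal_minors r (subst_col B i 0).
Proof.
have split_at v : sum_principal_minors r (subst_col B i v) =
    \sum_(b in idx_sets_at r i) principal_minor (subst_col B i v) b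
    + \sum_(b in idx_sets r n | i \notin b)
         principal_minor (subst_col B i v) b.
  rewrite /sum_principal_minors (bigID (fun b : {set _} => i \in b)) /=.
  by congr (_ + _); apply: eq_bigl => b; rewrite !inE.
rewrite !split_at [X in _ - (X + _)]big1 => [|b]; last first.
  by rewrite inE => /andP[_]; apply: principal_minor_subst_col0.
rewrite add0r; apply/esym/eqP; rewrite subr_eq; apply/eqP; congr (_ + _).
by apply: eq_bigr => b /andP[_]; apply: principal_minor_subst_col_notin.
Qed.

Lemma principal_minor_tr n (B : 'M[C]_n) (b : {set 'I_n}) :
  principal_minor B^T b = principal_minor B b.
Proof. by rewrite /principal_minor -[RHS]det_tr trmx_mxsub. Qed.

Lemma subst_row_tr m n (B : 'M[C]_(m, n)) j (v : 'rV_n) :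
  subst_row B j v = (subst_col B^T j v^T)^T.
Proof. by apply/matrixP=> k l; rewrite !mxE. Qed.

Lemma sum_principal_minors_tr k n (B : 'M[C]_n) :
  sum_principal_minors k B^T = sum_principal_minors k B.
Proof. by apply: eq_bigr => b _; rewrite principal_minor_tr. Qed.

End PrincipalMinorSums.

Section InvertibleGram.
Variable C : comUnitRingType.

(** The matrix determinant lemma. *)
Lemma det_add_rank1 n (Q : 'M[C]_n) (w : 'cV_n) (v : 'rV_n) :
  Q \in unitmx ->
  \det (Q + w *m v) = \det Q * (1 + (v *m invmx Q *m w) 0 0).
Proof.
move=> uQ; have -> : Q + w *m v = Q *m (1%:M + invmx Q *m w *m v).
  by rewrite mulmxDr mulmx1 !mulmxA mulmxV // mul1mx.
by rewrite det_mulmx det_add1_mulmxC det_mx11 mulmxA !mxE eqxx.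
Qed.

(** Cramer's rule read through the factorization [P *m V]: the minors of a
    possibly singular matrix compute the solution [P *m invmx (V *m P) *m u]. *)
Lemma sum_principal_minors_subst_col r n (V : 'M[C]_(r, n))
    (P : 'M[C]_(n, r)) i (u : 'cV_r) :
  V *m P \in unitmx ->
  \sum_(b in idx_sets_at r i)
     principal_minor (subst_col (P *m V) i (P *m u)) b =
  \det (V *m P) * (P *m invmx (V *m P) *m u) i 0.
Proof.
move=> uVP; rewrite sum_principal_minors_at -(mulmx0 _ P).
rewrite !subst_col_mulmx !sum_principal_minors_mulmx.
have detE v : \det (subst_col V i v *m P) =
    \det (V *m P) * (1 + (row i (P *m invmx (V *m P)) *m (v - col i V)) 0 0).
  by rewrite subst_colE mulmxDl -mulmxA -rowE det_add_rank1 // row_mul.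
rewrite !detE -mulrBr opprD addrACA subrr add0r; congr (_ * _).
rewrite sub0r mulmxBr mulmxN !mxE opprK subrK.
by apply: eq_bigr => k _; rewrite !mxE.
Qed.

End InvertibleGram.

Section MoorePenroseMinors.
Variable C : numClosedFieldType.

Lemma mpinv_tr m n (A : 'M[C]_(m, n)) : mpinv A^T = (mpinv A)^T.
Proof.
apply: mpinv_eq; have /and4P[/eqP AXA /eqP XAX /eqP AXt /eqP XAt] := mpinvP A.
apply/and4P; split; apply/eqP.
- by rewrite -!trmx_mul mulmxA AXA.
- by rewrite -!trmx_mul mulmxA XAX.
- by rewrite -trmx_mul -[in RHS]XAt map_trmx.
- by rewrite -trmx_mul -[in RHS]AXt map_trmx.
Qed.

(** Stated for an arbitrary full-rank factorization because the inner dimension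
    of [col_base A] and [row_base A] is [\rank A], which depends on [A]. *)
Lemma mpinv_full_rank_col_minors m n r
    (F : 'M[C]_(m, r)) (B : 'M[C]_(r, n)) i j :
    row_full F -> row_free B -> let A := F *m B in
  mpinv A i j =
    (\sum_(b in idx_sets_at r i)
        principal_minor (subst_col (A ^t* *m A) i (col j (A ^t*))) b)
    / sum_principal_minors r (A ^t* *m A).
Proof.
move=> fF fB /=; rewrite (mpinv_eq (is_mpinv_full_rank fF fB)).
have uF := row_full_gram_unit fF; have uB := row_free_gram_unit fB.
set GF := F ^t* *m F in uF *; set GB := B *m B ^t* in uB *.
have -> : (F *m B) ^t* *m (F *m B) = B ^t* *m (GF *m B).
  by rewrite trmxC_mul !mulmxA.
have -> : col j ((F *m B) ^t*) = B ^t* *m col j (F ^t*).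
  by rewrite trmxC_mul !colE mulmxA.
have VP : GF *m B *m B ^t* = GF *m GB by rewrite mulmxA.
have uVP : GF *m B *m B ^t* \in unitmx by rewrite VP unitmx_mul uF uB.
rewrite sum_principal_minors_subst_col // sum_principal_minors_mulmx.
rewrite mulrAC mulfV ?mul1r; last by rewrite -unitfE -unitmxE.
rewrite VP (_ : invmx (GF *m GB) = invmx GB *m invmx GF); last first.
  rewrite VP in uVP; rewrite -[RHS](mulmxK uVP) (mulmxA _ GF) mulmxKV //.
  by rewrite mulVmx // mul1mx.
by rewrite !mulmxA colE mulmxA -colE [RHS]mxE.
Qed.

Lemma mpinv_col_minors m n (A : 'M[C]_(m, n)) i j :
  mpinv A i j =
    (\sum_(b in idx_sets_at (\rank A) i)
        principal_minor (subst_col (A ^t* *m A) i (col j (A ^t*))) b)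
    / sum_principal_minors (\rank A) (A ^t* *m A).
Proof.
have := mpinv_full_rank_col_minors i j (col_base_full A) (row_base_free A).
by rewrite /= mulmx_base.
Qed.

Lemma mpinv_row_minors m n (A : 'M[C]_(m, n)) i j :
  mpinv A i j =
    (\sum_(a in idx_sets_at (\rank A) j)
        principal_minor (subst_row (A *m A ^t*) j (row i (A ^t*))) a)
    / sum_principal_minors (\rank A) (A *m A ^t*).
Proof.
have := mpinv_col_minors A^T j i; rewrite mpinv_tr mxE mxrank_tr => ->.
have -> : A^T ^t* *m A^T = (A *m A ^t*)^T by rewrite trmx_mul map_trmx.
rewrite sum_principal_minors_tr; congr (_ / _); apply: eq_bigr => a _.
by rewrite subst_row_tr principal_minor_tr tr_row map_trmx.
Qed.

End MoorePenroseMinors.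

Theorem theorem2p2 (R : realType) (m n r : nat) (A : 'M[R[i]]_(m, n))
    (rankA : \rank A = r) (r_ge1 : (1 <= r)%N) :
  (mpinv A =
     \matrix_(i < n, j < m)
       ((\sum_(b in idx_sets_at r i)
            principal_minor (subst_col (A ^t* *m A) i (col j (A ^t*))) b)
        / sum_principal_minors r (A ^t* *m A)))
  /\
  (mpinv A =
     \matrix_(i < n, j < m)
       ((\sum_(a in idx_sets_at r j)
            principal_minor (subst_row (A *m A ^t*) j (row i (A ^t*))) a)
        / sum_principal_minors r (A *m A ^t*))).
Proof.
rewrite -rankA; split; apply/matrixP=> i j; rewrite mxE.
  exact: mpinv_col_minors.
exact: mpinv_row_minors.
Qed.
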